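(* Let the set $Q$ be closed, let the functions $f$ and $\|\varphi(\cdot)\|$ be lower semicontinuous on $Q$, and let $\tau_1 \in \mathcal{T} \cap K^*_{++}$. Suppose also that the penalty function $\Phi_{\tau}$ is locally exact at every globally optimal solution of the problem $(\mathcal{P})$. Consider the Global Exact Penalty Method with Combined Penalty Updates described in the context, started from $\tau_1$, which is assumed to be well defined (the penalty parameters $\tau_n$ it generates belong to $\mathcal{T}$, and each penalized problem encountered has a globally optimal solution). Then the method either terminates after a finite number of iterations by finding a globally optimal solution of $(\mathcal{P})$, or generates an infinite sequence $\{x_n\}$ that has no limit points.
   Context: Setting. $(X,d)$ is a metric space, $M, Q \subseteq X$ satisfy $M \cap Q \neq \emptyset$, and $f \colon X \to \mathbb{R} \cup \{+\infty\}$. Problem $(\mathcal{P})$: minimize $f(x)$ subject to $x \in M \cap Q$. It is assumed that $(\mathcal{P})$ has a globally optimal solution and that its optimal value $f_*$ is finite. $Y$ is a real normed space, $K \subset Y$ is a closed convex pointed cone ($K \cap (-K) = \{0\}$). An improper element $\infty$ is added to $Y$, with $\|\infty\| = +\infty$. $\varphi \colon X \to K \cup \{\infty\}$ is a function such that $\varphi(x) = 0$ iff $x \in M$. $Y^*$ is the topological dual, $\langle\cdot,\cdot\rangle$ is the duality pairing, $K^* = \{y^* \in Y^* : \langle y^*, y\rangle \ge 0 \ \forall y \in K\}$, and $K^*_+ = \{y^* \in K^* : \langle y^*, y \rangle > 0 \ \forall y \in K \setminus \{0\}\}$, assumed nonempty. $K^*_{++}$ is the set of all $\tau \in K^*_+$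 for which there exists $c>0$ with $\langle \tau, y\rangle \ge c\|y\|$ for all $y \in K$. $\mathcal{T} \subset K^*_+$ is a fixed nonempty set with $\alpha\tau \in \mathcal{T}$ for all $\tau \in \mathcal{T}$, $\alpha>0$. It is assumed that there is an embedding $i \colon K \to K^*$ with $\mathcal{T} + i(K) \subseteq \mathcal{T}$. For $\tau \in \mathcal{T}$, $\Phi_\tau(x) = f(x) + \langle \tau, \varphi(x)\rangle$, where $\langle \tau, \infty\rangle = +\infty$. Problem $(\mathcal{P}_\tau)$: minimize $\Phi_\tau(x)$ subject to $x \in Q$. Write $\tau \succeq_{K^*} \tau_*$ iff $\tau - \tau_* \in K^*$. Local exactness. If $x_*$ is a locally optimal solution of $(\mathcal{P})$, $\Phi_\tau$ is locally exact at $x_*$ if there is $\tau_* \in \mathcal{T}$ such that for all $\tau \in \mathcal{T}$ with $\tau \succeq_{K^*} \tau_*$ the point $x_*$ is a locally optimal solution of $(\mathcal{P}_\tau)$. A limit point of a sequence is the limit of some convergent subsequence. Global Exact Penalty Method with Combined Penalty Updates. Choose $\tau_1 \in \mathcal{T}$ and $\delta > 0$; set $n := 1$. Main step: let $x_n$ be a globally optimal solution of $(\mathcal{P}_{\tau_n})$. If $x_n$ is feasible for $(\mathcal{P})$ (i.e. $x_n \in M \cap Q$), stop. Otherwise choose a scaling coefficient $s_n > 0$, put $\tau_{n+1} = \tau_n + \delta \tau_1 + s_n i(\varphi(x_n))$, $n := n+1$, and repeat the main step. *)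

(* Defs.v *)
From HB Require Import structures.
From mathcomp Require Import all_boot all_order all_algebra.
From mathcomp Require Import all_classical all_reals all_analysis.

Set Implicit Arguments.
Unset Strict Implicit.
Unset Printing Implicit Defensive.

Import Order.TTheory GRing.Theory Num.Theory.
Import numFieldNormedType.Exports.

Local Open Scope classical_set_scope.
Local Open Scope ring_scope.

Section Optimization.
Context {R : realType} {X : metricType R}.
Implicit Types (A : set X) (g : X -> \bar R).

Definition global_solution A g : set X :=
  [set x | A x /\ forall z, A z -> (g x <= g z)%E].

Definition local_solution A g : set X :=
  [set x | A x /\ \forall z \near x, A z -> (g x <= g z)%E].

(* Semicontinuity of the restriction of g to A. *)
Definition lower_semicontinuous_on A g : Prop :=
  lower_semicontinuous (g : subspace A -> \bar R).

Definition seq_limit_point (x : nat -> X) (p : X) : Prop :=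
  exists2 k : nat -> nat, increasing_seq k & (x \o k) @ \oo --> p.

End Optimization.

Section Dual.
Context {R : realType} {Y : normedModType R}.
Implicit Types (K : set Y) (t : Y -> R^o).

Definition closed_convex_pointed_cone K : Prop :=
  [/\ closed K,
      convex_set (K : set (convex_lmodType Y)),
      forall (a : R) y, 0 <= a -> K y -> K (a *: y) &
      K `&` [set - y | y in K] = [set 0]].

(* Functionals live in the module Y -> R^o, with the pointwise operations. *)
Definition topological_dual : set (Y -> R^o) :=
  [set t | linear t /\ continuous t].

Definition dual_cone K : set (Y -> R^o) :=
  [set t | topological_dual t /\ forall y, K y -> 0 <= t y].

Definition dual_cone_pos K : set (Y -> R^o) :=
  [set t | dual_cone K t /\ forall y, K y -> y <> 0 -> 0 < t y].

Definition dual_cone_upos K : set (Y -> R^o) :=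
  [set t | dual_cone_pos K t /\
    exists2 c : R, 0 < c & forall y, K y -> c * `|y| <= t y].

End Dual.

(* The improper element of Y is represented by None : option Y. *)
Section Penalty.
Context {R : realType} {X : metricType R} {Y : normedModType R}.
Implicit Types (f : X -> \bar R) (phi : X -> option Y).

Definition enorm (y : option Y) : \bar R :=
  if y is Some v then `|v|%:E else +oo%E.

Definition epairing (t : Y -> R^o) (y : option Y) : \bar R :=
  if y is Some v then (t v : R)%:E else +oo%E.

Definition penalty f phi (t : Y -> R^o) (x : X) : \bar R :=
  (f x + epairing t (phi x))%E.

Definition locally_exact (M Q : set X) f (K : set Y) phi
    (T : set (Y -> R^o)) (xs : X) : Prop :=
  local_solution (M `&` Q) f xs /\
  exists2 ts, T ts &
    forall t, T t -> dual_cone K (t - ts) ->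
      local_solution Q (penalty f phi t) xs.

(* The iterates are numbered from 0, and they are total sequences whose values
   past the stopping iteration are irrelevant: iteration n takes place only if
   no earlier iterate is feasible. *)
Definition reached (M Q : set X) (x : nat -> X) (n : nat) : Prop :=
  forall k, (k < n)%N -> ~ (M `&` Q) (x k).

(* reached n.+1 says that iteration n takes place and does not stop. *)
Record combined_update_run (M Q : set X) f phi (i : Y -> (Y -> R^o))
    (tau1 : Y -> R^o) (delta : R)
    (x : nat -> X) (tau : nat -> (Y -> R^o)) (s : nat -> R) : Prop := {
  run_init : tau 0%N = tau1;
  run_solution : forall n, reached M Q x n ->
    global_solution Q (penalty f phi (tau n)) (x n);
  run_scaling : forall n, reached M Q x n.+1 -> 0 < s n;
  run_update : forall n y, reached M Q x n.+1 -> phi (x n) = Some y ->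
    tau n.+1 = tau n + delta *: tau1 + s n *: i y
}.

End Penalty.

(* Main.v *)
Require Import Defs.
From mathcomp Require Import all_boot all_order all_algebra.
From mathcomp Require Import all_classical all_reals all_analysis.
From HB Require Import structures.
From mathcomp Require Import lra.
Import Order.TTheory GRing.Theory Num.Theory.
Import numFieldNormedType.Exports.
Local Open Scope classical_set_scope.
Local Open Scope ring_scope.

(** If the method stops, its last iterate is feasible and minimizes a penalty
    function that agrees with f at feasible points, so it solves the original
    problem.

    Suppose that it never stops and that a subsequence of the iterates converges
    to p. On K the parameter tau n dominates (1 + n delta) tau1
    [combined_update_growth], and tau1 dominates c times the norm; hence
    f (x n) + w n * `|phi (x n)| <= b, where w n = (1 + n delta) c grows without
    bound and b is the optimal value [penalized_solution_value]. Letting n tend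
    to infinity along the subsequence, phi p = 0 and f p <= b
    [penalized_limit]: the point p is a globally optimal solution.

    By local exactness p is then a local minimizer on Q of the penalty function
    with some fixed parameter ts, so that b <= f (x n) + ts (phi (x n)) for the
    iterates close to p. But ts is a bounded functional, and phi (x n) is nonzero
    because x n is infeasible; once w n exceeds the norm of ts, the right-hand
    side is strictly less than f (x n) + w n * `|phi (x n)| <= b, which is a
    contradiction. *)

Section Preliminaries.
Context {R : realType} {X : metricType R} {Y : normedModType R}.
Implicit Types (M Q A : set X) (K : set Y) (t : Y -> R^o).
Implicit Types (f g : X -> \bar R) (phi : X -> option Y) (i : Y -> Y -> R^o).

(** This turns neighbourhoods in the subspace A into neighbourhoods in X. *)
Lemma lower_semicontinuous_on_near {A g} {p : X} {a : R} :
  lower_semicontinuous_on A g -> A p -> (a%:E < g p)%E ->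
  \forall z \near p, A z -> (a%:E < g z)%E.
Proof.
move=> g_lsc Ap agp; have [V Vp Vg] := g_lsc p a agp.
have {}Vp : within A (nbhs p) V by rewrite nbhs_subspace_in.
by apply: (@filterS _ (within A (nbhs p)) _ _ _ Vg Vp).
Qed.

Lemma topological_dual_bounded {t} : topological_dual t ->
  exists B : R, forall y, t y <= B * `|y|.
Proof.
move=> [tlin tcont].
pose tL := GRing.isLinear.Build R Y R^o _ t tlin.
pose h : {linear Y -> R^o} := HB.pack t tL.
have /linear_boundedP : bounded_near h (nbhs (0 : Y)).
  by apply: continuous_linear_bounded; exact: tcont.
move=> [B [Breal hB]].
exists (B + 1) => y; apply: le_trans (ler_norm _) _.
by apply: hB; rewrite ltrDl.
Qed.

Lemma topological_dual0 {t} : topological_dual t -> t 0 = 0.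
Proof.
move=> [tlin _]; pose tL := GRing.isLinear.Build R Y R^o _ t tlin.
pose h : {linear Y -> R^o} := HB.pack t tL.
exact: (linear0 h).
Qed.

Lemma dual_cone0 K : dual_cone K (0 : Y -> R^o).
Proof.
split; last by move=> y _; exact: lexx.
split; first by move=> a u v; rewrite scaler0 addr0.
exact: (@cst_continuous Y R^o 0).
Qed.

(** Feasible points are not penalized, so a feasible minimizer of a penalty
    function is a minimizer of the original problem. *)
Lemma penalty_feasible {f phi t} {z : X} :
  topological_dual t -> phi z = Some 0 -> penalty f phi t z = f z.
Proof. by move=> /topological_dual0 t0 phiz; rewrite /penalty phiz /= t0 adde0. Qed.

Lemma optimal_value_fin {A f} {xs : X} : global_solution A f xs ->
  ereal_inf (f @` A) \is a fin_num -> f xs = (fine (f xs))%:E.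
Proof.
move=> [Axs xs_min] inf_fin.
suff -> : f xs = ereal_inf (f @` A) by rewrite fineK.
apply/eqP; rewrite eq_le; apply/andP; split.
  by apply: le_ereal_inf_tmp => _ [z Az <-]; exact: xs_min.
by apply: ereal_inf_lbound; exists xs.
Qed.

(** Comparing z with a feasible point xs shows that neither f z nor phi z takes
    an infinite value; the comparison then becomes an inequality between real
    numbers, with the optimal value b as a bound independent of t. *)
Lemma penalized_solution_value {M Q f phi t} {z xs : X} {b : R} :
  (forall z, f z <> -oo%E) -> (forall z, phi z = Some 0 <-> M z) ->
  topological_dual t -> (M `&` Q) xs -> f xs = b%:E ->
  global_solution Q (penalty f phi t) z ->
  exists r y, [/\ f z = r%:E, phi z = Some y & r + t y <= b].
Proof.
move=> f_proper phi_M t_dual [Mxs Qxs] fxs [Qz /(_ _ Qxs)].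
rewrite (penalty_feasible (z := xs) t_dual) ?fxs; last exact/phi_M.
rewrite /penalty; have := f_proper z.
case: (f z) => [r| |] // _; case: (phi z) => [y|] //= le_b.
by exists r, y; split => //; rewrite -lee_fin EFinD.
Qed.

(** Lower semicontinuity keeps f bounded from below along u, so the bound b on
    the penalized values leaves for the norms of phi only a constant divided by
    w; as w tends to infinity these norms tend to 0, and lower semicontinuity
    passes this to p. The bound on f p comes from the penalty term being
    nonnegative as soon as w is. *)
Lemma penalized_limit {Q f phi} {u : nat -> X} {p : X} {w : nat -> R} {b : R} :
  closed Q -> lower_semicontinuous_on Q f ->
  lower_semicontinuous_on Q (fun z => enorm (phi z)) -> f p <> -oo%E ->
  u @ \oo --> p -> (forall a, \forall j \near \oo, a <= w j) ->
  (forall j, Q (u j)) ->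
  (forall j, exists r y, [/\ f (u j) = r%:E, phi (u j) = Some y &
     r + w j * `|y| <= b]) ->
  [/\ Q p, (f p <= b%:E)%E & phi p = Some 0].
Proof.
move=> Qcl f_lsc phi_lsc fp up w_oo Qu uE.
have Qp : Q p by apply: (closed_cvg Q) up => //; exact: nearW.
have near_gt g (a : R) : lower_semicontinuous_on Q g -> (a%:E < g p)%E ->
    \forall j \near \oo, (a%:E < g (u j))%E.
  move=> g_lsc agp.
  have near_u := up _ (lower_semicontinuous_on_near g_lsc Qp agp).
  have {}near_u : \forall j \near \oo, Q (u j) -> (a%:E < g (u j))%E by [].
  by apply: filterS near_u => j; apply.
split=> //.
- rewrite leNgt; apply/negP => bfp.
  have [j [w0 fuj]] := filter_ex (filterI (w_oo 0) (near_gt _ _ f_lsc bfp)).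
  have [r [y [fE _ le_b]]] := uE j.
  move: fuj; rewrite fE lte_fin ltNge => /negP; apply.
  by apply: le_trans le_b; rewrite lerDl; apply: mulr_ge0 (normr_ge0 _).
- have [m mfp] : exists m : R, (m%:E < f p)%E.
    case: (f p) fp => [r| |] // _; last by exists 0; rewrite ltry.
    by exists (r - 1); rewrite lte_fin gtrBl.
  (* A bound by every positive real also rules out that phi p is improper. *)
  have phi_le a : 0 < a -> (enorm (phi p) <= a%:E)%E.
    move=> a0; rewrite leNgt; apply/negP => aphi.
    have [j [[w0 wj] [fuj phiuj]]] := filter_ex (filterI
      (filterI (w_oo 0) (w_oo ((b - m) / a)))
      (filterI (near_gt _ _ f_lsc mfp) (near_gt _ _ phi_lsc aphi))).
    have [r [y [fE phiE le_b]]] := uE j.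
    move: fuj phiuj; rewrite fE phiE /= !lte_fin => mr ay.
    have : b - m <= w j * `|y|.
      apply: (@le_trans _ _ (w j * a)); first by rewrite -ler_pdivrMr.
      by rewrite ler_wpM2l// ltW.
    lra.
  case phip : (phi p) phi_le => [y|] phi_le; last by have := phi_le 1 ltr01.
  congr Some; apply/normr0_eq0/le_anti; rewrite normr_ge0 andbT.
  by apply/ler_addgt0Pr => a a0; rewrite add0r -lee_fin; exact: phi_le.
Qed.

(** Each update adds delta times tau1 and a nonnegative multiple of i (phi (x n)),
    a functional nonnegative on K; discarding the latter leaves a bound that
    does not depend on the scaling coefficients s. *)
Lemma combined_update_growth {M Q K f phi i} {tau1 : Y -> R^o} {delta : R}
    {x : nat -> X} {tau : nat -> Y -> R^o} {s : nat -> R} :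
  combined_update_run M Q f phi i tau1 delta x tau s ->
  (forall y, K y -> dual_cone K (i y)) ->
  (forall n, ~ (M `&` Q) (x n)) ->
  (forall n, exists2 y, phi (x n) = Some y & K y) ->
  forall n y, K y -> (1 + delta *+ n) * tau1 y <= tau n y.
Proof.
move=> [tau0 _ s_gt0 tauS] i_dual infeas phi_fin.
elim=> [|n IHn] y Ky; first by rewrite tau0 mulr0n addr0 mul1r.
have reachS : reached M Q x n.+1 by move=> k _; exact: infeas.
have [v phiE Kv] := phi_fin n.
have [_ /(_ y Ky) iv_ge0] := i_dual v Kv.
rewrite (tauS n v reachS phiE).
rewrite mulrSr addrA mulrDl.
change ((1 + delta *+ n) * tau1 y + delta * tau1 y <=
        tau n y + delta * tau1 y + s n * i v y).
rewrite -[leLHS]addr0 lerD ?lerD ?IHn// mulr_ge0// ltW//; exact: s_gt0.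
Qed.

End Preliminaries.

Theorem theorem5 (R : realType) (X : metricType R) (Y : normedModType R)
  (M Q : set X) (f : X -> \bar R)
  (MQ_neq0 : M `&` Q !=set0)
  (f_proper : forall x, f x <> -oo%E)
  (P_solvable : global_solution (M `&` Q) f !=set0)
  (P_finite : ereal_inf (f @` (M `&` Q)) \is a fin_num)
  (K : set Y) (K_cone : closed_convex_pointed_cone K)
  (phi : X -> option Y)
  (phi_K : forall x y, phi x = Some y -> K y)
  (phi_M : forall x, phi x = Some 0 <-> M x)
  (Kpos_neq0 : dual_cone_pos K !=set0)
  (T : set (Y -> R^o)) (T_neq0 : T !=set0)
  (T_pos : T `<=` dual_cone_pos K)
  (T_scale : forall t (a : R), T t -> 0 < a -> T (a *: t))
  (i : Y -> (Y -> R^o))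
  (i_dual : forall y, K y -> dual_cone K (i y))
  (i_inj : forall y z, K y -> K z -> i y = i z -> y = z)
  (T_i : forall t y, T t -> K y -> T (t + i y))
  (Q_closed : closed Q)
  (f_lsc : lower_semicontinuous_on Q f)
  (phi_lsc : lower_semicontinuous_on Q (fun x => enorm (phi x)))
  (tau1 : Y -> R^o) (tau1_T : T tau1) (tau1_upos : dual_cone_upos K tau1)
  (exact_P : forall xs, global_solution (M `&` Q) f xs ->
    locally_exact M Q f K phi T xs)
  (delta : R) (delta_gt0 : 0 < delta)
  (x : nat -> X) (tau : nat -> (Y -> R^o)) (s : nat -> R)
  (run : combined_update_run M Q f phi i tau1 delta x tau s)
  (tau_T : forall n, reached M Q x n -> T (tau n))
  (Ptau_solvable : forall n, reached M Q x n ->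
    global_solution Q (penalty f phi (tau n)) !=set0) :
  (exists n, [/\ reached M Q x n, (M `&` Q) (x n) &
                 global_solution (M `&` Q) f (x n)]) \/
  ((forall n, ~ (M `&` Q) (x n)) /\ forall p, ~ seq_limit_point x p).
Proof.
have [xs xs_opt] := P_solvable.
have [xs_feas xs_min] := xs_opt.
pose b := fine (f xs).
have fxs : f xs = b%:E := optimal_value_fin xs_opt P_finite.
have T_dual t : T t -> topological_dual t by move=> /T_pos[[]].
have [[n0 xn0]|infeas] := pselect (exists n, (M `&` Q) (x n)).
  left; have /ex_minnP[n /asboolP xn n_min] : exists n, `[< (M `&` Q) (x n) >].
    by exists n0; exact/asboolP.
  have reach : reached M Q x n.
    by move=> k kn /asboolP /n_min; rewrite leqNgt kn.
  exists n; split => //; split => // z [Mz Qz].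
  have tn_dual := T_dual _ (tau_T _ reach).
  have [_ /(_ z Qz)] := run_solution run reach.
  by rewrite !(penalty_feasible tn_dual) //; apply/phi_M => //; case: xn.
right.
(* From here on the method never stops, so every iteration takes place. *)
have {}infeas n : ~ (M `&` Q) (x n) by move=> xn; apply: infeas; exists n.
split=> // p [k k_incr xkp].
have reach n : reached M Q x n by move=> j _; exact: infeas.
have Qx n : Q (x n) by have [] := run_solution run (reach n).
have value n := penalized_solution_value f_proper phi_M
  (T_dual _ (tau_T _ (reach n))) xs_feas fxs (run_solution run (reach n)).
have phi_fin n : exists2 y, phi (x n) = Some y & K y.
  by have [_ [y [_ phiE _]]] := value n; exists y => //; exact: phi_K phiE.
have growth := combined_update_growth run i_dual infeas phi_fin.
have [_ [c c_gt0 tau1_ge]] := tau1_upos.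
pose w n := (1 + delta *+ n) * c.
have w_le n y : K y -> w n * `|y| <= tau n y.
  move=> Ky; apply: le_trans (growth n y Ky); rewrite -mulrA ler_wpM2l ?tau1_ge//.
  by rewrite addr_ge0// mulrn_wge0// ltW.
have w_oo a : \forall j \near \oo, a <= w (k j).
  have := nbhs_infty_ger (a / (delta * c)); apply: filterS => j le_j.
  have kj : (j%:R : R) <= (k j)%:R by rewrite ler_nat (unstable.mono_leq_infl k_incr).
  rewrite /w -mulr_natl; have : a <= j%:R * (delta * c).
    by rewrite -ler_pdivrMr// mulr_gt0.
  have : j%:R * (delta * c) <= (k j)%:R * (delta * c).
    by rewrite ler_wpM2r// mulr_ge0// ltW.
  lra.
have [Qp fp_le phip] : [/\ Q p, (f p <= b%:E)%E & phi p = Some 0].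
  apply: (penalized_limit Q_closed f_lsc phi_lsc (f_proper p) xkp w_oo) => j //=.
  have [r [y [fE phiE le_b]]] := value (k j).
  exists r, y; split => //; apply: le_trans le_b.
  by rewrite lerD2l w_le//; exact: phi_K phiE.
have p_opt : global_solution (M `&` Q) f p.
  split=> [|z /xs_min]; first by split=> //; exact/phi_M.
  by rewrite fxs; exact: le_trans.
have [_ [ts Tts /(_ ts Tts)]] := exact_P p p_opt.
(* The neighbourhood given by local exactness depends on the parameter, so the
   fixed threshold ts is used instead of the varying parameters tau n. *)
rewrite subrr => /(_ (dual_cone0 K)) [_ /xkp p_loc].
have [B ts_le] := topological_dual_bounded (T_dual _ Tts).
have {}p_loc : \forall j \near \oo,
    Q (x (k j)) -> (penalty f phi ts p <= penalty f phi ts (x (k j)))%E.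
  exact: p_loc.
(* Beyond this index the weight strictly dominates the functional ts. *)
have [j [loc wB]] := filter_ex (filterI p_loc (w_oo (B + 1))).
have [r [y [fE phiE le_b]]] := value (k j).
have Ky : K y := phi_K _ _ phiE.
have y_gt0 : 0 < `|y|.
  rewrite normr_gt0; apply/eqP => y0; apply: (infeas (k j)).
  by split=> //; apply/phi_M; rewrite phiE y0.
have := loc (Qx _).
rewrite (penalty_feasible (T_dual _ Tts) phip).
have -> : f p = b%:E.
  apply/le_anti; rewrite fp_le /= -fxs; apply: xs_min.
  by case: p_opt.
rewrite /penalty fE phiE /= -EFinD lee_fin => b_le.
have : (B + 1) * `|y| <= w (k j) * `|y| by rewrite ler_pM2r.
have := w_le (k j) y Ky; have := ts_le y.
lra.
Qed.
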